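(* Let $\Phi=\{\Phi_j\}_{j=1}^J$ be a self-affine system on $\mathbb{R}^d$ with attractor $F$ and convex hull $C=[F]$, $\dim C=d$, satisfying the tileset condition and the nontriviality condition, with generators $\{G_q\}_{q=1}^Q$ and self-affine tiling $\mathcal{T}=\{\Phi_w(G_q): w\in W,\ q=1,\dots,Q\}$. Then $\mathcal{T}$ is subselfaffine in that $$\Phi(\mathcal{T})=\mathcal{T}\setminus\{G_q: q=1,\dots,Q\},$$ where $\Phi(\mathcal{T}):=\{\Phi_j(R): R\in\mathcal{T},\ j=1,\dots,J\}$ and both sides are collections of subsets of $\mathbb{R}^d$.
   Context: A self-affine system on $\mathbb{R}^d$ is a finite family $\Phi=\{\Phi_j\}_{j=1}^J$, $2\le J<\infty$, of invertible affine maps $\Phi_j:\mathbb{R}^d\to\mathbb{R}^d$, each of which is a contraction for the Euclidean norm. Its action on sets is $\Phi(A):=\bigcup_{j=1}^J\Phi_j(A)$ for $A\subseteq\mathbb{R}^d$. The attractor $F$ is the unique nonempty compact set with $F=\Phi(F)$. $C:=[F]$ is the convex hull of $F$; $\dim C=d$ means the smallest affine subspace containing $C$ is $\mathbb{R}^d$. Tileset condition: $\operatorname{int}\Phi_j(C)\cap\operatorname{int}\Phi_\ell(C)=\emptyset$ for all $j\ne\ell$. Nontriviality condition: $\operatorname{int}C\not\subseteq\Phi(C)$. The generators $G_1,\dots,G_Q$ are the connected components of the open set $\operatorname{int}(C\setminus\Phi(C))$; their number $Q$ is finite or countably infinite ($Q=\infty$ is not excluded). $W:=\bigcup_{k\ge0}\{1,\dots,J\}^k$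 is the set of finite words, including the empty word, and for $w=w_1\cdots w_k$, $\Phi_w:=\Phi_{w_1}\circ\cdots\circ\Phi_{w_k}$ (the identity for the empty word). Interior is taken in $\mathbb{R}^d$. *)

(* Defs.v *)
From mathcomp Require Import all_boot all_order all_algebra.
From mathcomp Require Import all_classical all_reals all_analysis.

Set Implicit Arguments.
Unset Strict Implicit.
Unset Printing Implicit Defensive.

Import Order.TTheory GRing.Theory Num.Theory.
Import numFieldNormedType.Exports.

Local Open Scope classical_set_scope.
Local Open Scope ring_scope.

(* R^d is the type 'rV[R]_d of row vectors.  The library
   norm on 'rV[R]_d is the sup norm, so the Euclidean norm is defined
   here; the library topology on 'rV[R]_d is the product topology, i.e. the
   usual topology of R^d, so compact, interior and connected_component have
   their usual meaning. *)

Definition enorm (R : realType) (d : nat) (x : 'rV[R]_d) : R :=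
  Num.sqrt (\sum_(i < d) x ord0 i ^+ 2).

Definition invertible_affine (R : realType) (d : nat)
    (f : 'rV[R]_d -> 'rV[R]_d) : Prop :=
  exists (A : 'M[R]_d) (b : 'rV[R]_d),
    A \in unitmx /\ forall x, f x = x *m A + b.

Definition euclidean_contraction (R : realType) (d : nat)
    (f : 'rV[R]_d -> 'rV[R]_d) : Prop :=
  exists c : R, 0 <= c < 1 /\ forall x y, enorm (f x - f y) <= c * enorm (x - y).

Definition self_affine_system (R : realType) (d J : nat)
    (Phi : 'I_J -> 'rV[R]_d -> 'rV[R]_d) : Prop :=
  (2 <= J)%N /\
  forall j, invertible_affine (Phi j) /\ euclidean_contraction (Phi j).

Definition system_image (R : realType) (d J : nat)
    (Phi : 'I_J -> 'rV[R]_d -> 'rV[R]_d) (A : set 'rV[R]_d) : set 'rV[R]_d :=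
  \bigcup_j (Phi j @` A).

(* By Hutchinson's theorem these conditions determine F when Phi is a
   self-affine system. *)
Definition is_attractor (R : realType) (d J : nat)
    (Phi : 'I_J -> 'rV[R]_d -> 'rV[R]_d) (F : set 'rV[R]_d) : Prop :=
  [/\ F !=set0, compact F & F = system_image Phi F].

Definition convex_hull (R : realType) (d : nat) (A : set 'rV[R]_d) :
    set 'rV[R]_d :=
  smallest (@convex_set R 'rV[R]_d) A.

(* The translate by p of the linear subspace spanned by the rows of U. *)
Definition affine_subspace (R : realType) (d : nat) (A : set 'rV[R]_d) : Prop :=
  exists (p : 'rV[R]_d) (U : 'M[R]_d), A = [set x | (x - p <= U)%MS].

Definition full_dimensional (R : realType) (d : nat) (A : set 'rV[R]_d) : Prop :=
  smallest (@affine_subspace R d) A = setT.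

Definition tileset_condition (R : realType) (d J : nat)
    (Phi : 'I_J -> 'rV[R]_d -> 'rV[R]_d) (C : set 'rV[R]_d) : Prop :=
  forall j l : 'I_J, j != l ->
    interior (Phi j @` C) `&` interior (Phi l @` C) = set0.

Definition nontriviality_condition (R : realType) (d J : nat)
    (Phi : 'I_J -> 'rV[R]_d -> 'rV[R]_d) (C : set 'rV[R]_d) : Prop :=
  ~ (interior C `<=` system_image Phi C).

Definition generators (R : realType) (d J : nat)
    (Phi : 'I_J -> 'rV[R]_d -> 'rV[R]_d) (C : set 'rV[R]_d) :
    set (set 'rV[R]_d) :=
  let U := interior (C `\` system_image Phi C) in
  [set connected_component U x | x in U].

Definition word_map (R : realType) (d J : nat)
    (Phi : 'I_J -> 'rV[R]_d -> 'rV[R]_d) (w : seq 'I_J) :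
    'rV[R]_d -> 'rV[R]_d :=
  foldr (fun j f => Phi j \o f) id w.

Definition tiling (R : realType) (d J : nat)
    (Phi : 'I_J -> 'rV[R]_d -> 'rV[R]_d) (C : set 'rV[R]_d) :
    set (set 'rV[R]_d) :=
  [set word_map Phi w @` G | w in [set: seq 'I_J] & G in generators Phi C].

Definition collection_image (R : realType) (d J : nat)
    (Phi : 'I_J -> 'rV[R]_d -> 'rV[R]_d) (T : set (set 'rV[R]_d)) :
    set (set 'rV[R]_d) :=
  [set Phi j @` A | j in [set: 'I_J] & A in T].

(* Main.v *)
Require Import Defs.
From mathcomp Require Import all_boot all_order all_algebra.
From mathcomp Require Import all_classical all_reals all_analysis.

Import GRing.Theory.

Local Open Scope classical_set_scope.
Local Open Scope ring_scope.

(** A tile [word_map Phi w @` G] with [w] nonempty is an image under some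
    [Phi j] of a tile, so the tiling is the union of the generators and of
    [collection_image Phi] of the tiling; the claim is thus that these two
    collections are disjoint.  An affine map sends the convex hull of a set
    into the convex hull of any set containing its image, and [Phi j] maps [F]
    into [F], so [Phi j] maps [C] into itself ([attractor_hull_invariant]).
    Consequently every tile lies in [C] ([tile_sub]), and its image under any
    [Phi j] lies in [system_image Phi C].  A generator is by construction
    disjoint from [system_image Phi C]; as tiles are nonempty, the image of a
    tile is never a generator. *)

Lemma conv_affine (R : realType) (d : nat) (f : 'rV[R]_d -> 'rV[R]_d)
    (t : {i01 R}) (x y : convex_lmodType 'rV[R]_d) :
  invertible_affine f -> f (conv t x y) = conv t (f x : convex_lmodType _) (f y).
Proof.
move=> [A [b [_ fE]]].
have convE (u v : 'rV[R]_d) :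
    conv t (u : convex_lmodType _) v = t%:num *: u + (1 - t%:num) *: v by [].
rewrite !convE !fE mulmxDl -!scalemxAl !scalerDr addrACA -scalerDl.
by rewrite [_ + (1 - _)]addrC subrK scale1r.
Qed.

Lemma convex_set_preimage (R : realType) (d : nat) (f : 'rV[R]_d -> 'rV[R]_d)
    (A : set 'rV[R]_d) :
  invertible_affine f -> @convex_set R 'rV[R]_d A ->
  @convex_set R 'rV[R]_d (f @^-1` A).
Proof.
move=> af cA x y t; rewrite !inE /= => fx fy.
rewrite (@conv_affine _ _ _ t _ _ af).
by apply/set_mem/cA; apply/mem_set.
Qed.

Lemma convex_set_hull (R : realType) (d : nat) (A : set 'rV[R]_d) :
  @convex_set R 'rV[R]_d (convex_hull A).
Proof.
move=> x y t /set_mem xA /set_mem yA; apply/mem_set => B [cB AB].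
by apply/set_mem/cB; apply/mem_set; [exact: xA | exact: yA].
Qed.

(** The preimage of the hull of [B] is a convex set containing [A], hence it
    contains the hull of [A]. *)
Lemma affine_image_hull (R : realType) (d : nat) (f : 'rV[R]_d -> 'rV[R]_d)
    (A B : set 'rV[R]_d) :
  invertible_affine f -> f @` A `<=` B ->
  f @` convex_hull A `<=` convex_hull B.
Proof.
move=> af fAB _ [x xA <-].
apply: (smallest_sub (convex_set_preimage _ _ _ _ af (convex_set_hull _ _ B)) _ xA).
by move=> y Ay; apply: sub_gen_smallest; apply: fAB; exists y.
Qed.

Lemma attractor_hull_invariant (R : realType) (d J : nat)
    (Phi : 'I_J -> 'rV[R]_d -> 'rV[R]_d) (F : set 'rV[R]_d) (j : 'I_J) :
  self_affine_system Phi -> is_attractor Phi F ->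
  Phi j @` convex_hull F `<=` convex_hull F.
Proof.
move=> [_ /(_ j) [af _]] [_ _ FE]; apply: affine_image_hull => // y Fy.
by rewrite FE; exists j.
Qed.

Section Tiles.
Variables (R : realType) (d J : nat) (Phi : 'I_J -> 'rV[R]_d -> 'rV[R]_d).
Variable C : set 'rV[R]_d.

Lemma generator_sub (G : set 'rV[R]_d) :
  generators Phi C G -> G `<=` C `\` system_image Phi C.
Proof.
by move=> [x _ <-] y /connected_component_sub /interior_subset.
Qed.

Lemma generator_nonempty (G : set 'rV[R]_d) : generators Phi C G -> G !=set0.
Proof. by move=> [x Ux <-]; exists x; exact: connected_component_refl. Qed.

Lemma tile_nonempty (T : set 'rV[R]_d) : tiling Phi C T -> T !=set0.
Proof.
by move=> [w _ [G /generator_nonempty [x Gx] <-]]; exists (word_map Phi w x), x.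
Qed.

Lemma generator_tile : generators Phi C `<=` tiling Phi C.
Proof. by move=> G gG; exists [::] => //; exists G => //; rewrite image_id. Qed.

Lemma image_word_cons (j : 'I_J) (w : seq 'I_J) (A : set 'rV[R]_d) :
  word_map Phi (j :: w) @` A = Phi j @` (word_map Phi w @` A).
Proof. by rewrite image_comp. Qed.

Lemma tilingE :
  tiling Phi C = generators Phi C `|` collection_image Phi (tiling Phi C).
Proof.
apply/seteqP; split=> [_ [[|j w] _ [G gG <-]]|T [/generator_tile //|]].
- by left; rewrite image_id.
- right; rewrite image_word_cons; exists j => //.
  by exists (word_map Phi w @` G) => //; exists w => //; exists G.
- move=> [j _ [_ [w _ [G gG <-]] <-]]; exists (j :: w) => //; exists G => //.
  exact: image_word_cons.
Qed.

Hypothesis Cinv : forall j, Phi j @` C `<=` C.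

Lemma tile_sub (T : set 'rV[R]_d) : tiling Phi C T -> T `<=` C.
Proof.
move=> [w _ [G /generator_sub GC <-]].
elim: w => [|j w IHw]; first by rewrite image_id => x /GC [].
rewrite image_word_cons; apply: subset_trans (Cinv j).
exact: image_subset.
Qed.

Lemma collection_image_not_generator (T : set 'rV[R]_d) :
  collection_image Phi (tiling Phi C) T -> ~ generators Phi C T.
Proof.
move=> [j _ [S tS <-]] /generator_sub sub.
have [x Sx] := tile_nonempty _ tS.
have [_] := sub _ (imageP (Phi j) Sx); apply.
by exists j => //; apply: imageP; exact: tile_sub tS _ Sx.
Qed.

End Tiles.

Theorem corollary5p17 (R : realType) (d J : nat)
    (Phi : 'I_J -> 'rV[R]_d -> 'rV[R]_d) (F C : set 'rV[R]_d)
    (hPhi : self_affine_system Phi)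
    (hF : is_attractor Phi F)
    (hC : C = convex_hull F)
    (hdim : full_dimensional C)
    (htile : tileset_condition Phi C)
    (hnontriv : nontriviality_condition Phi C) :
  collection_image Phi (tiling Phi C) = tiling Phi C `\` generators Phi C.
Proof.
have Cinv j : Phi j @` C `<=` C.
  by rewrite hC; exact: attractor_hull_invariant.
apply/seteqP; split=> T.
  move=> imT; split; first by rewrite tilingE; right.
  exact: collection_image_not_generator imT.
by move=> [+ nT]; rewrite {1}tilingE => -[].
Qed.
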